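(* Let $k,\ell\ge2$ be integers. Any minimal $(k,\ell)$-crucial permutation $\sigma=\sigma_1\cdots\sigma_n$ is of length $n=k+\ell-3$ and has the following form: (1) the final element is $\sigma_n=k-1$; (2) the first $n-1=k+\ell-4$ positions of $\sigma$ are occupied by interleaved occurrences of the pattern $i_{k-2}$ formed by the elements in $\{1,\ldots,k-2\}$ and the pattern $d_{\ell-2}$ formed by the elements in $\{k,\ldots,k+\ell-3\}$ (that is, the elements of $\{1,\ldots,k-2\}$ appear in increasing order and the elements of $\{k,\ldots,k+\ell-3\}$ appear in decreasing order). In particular, any minimal $(k,\ell)$-crucial permutation begins with either the smallest or the largest element.
   Context: $i_m=12\cdots m$ and $d_m=m(m-1)\cdots 1$ (empty for $m=0$); a permutation (in one-line notation) contains $i_m$ (resp. $d_m$) if it has an increasing (resp. decreasing) subsequence of length $m$, and avoids it otherwise. The extensions of a permutation $\sigma=\sigma_1\cdots\sigma_n$ of $\{1,\ldots,n\}$ ($n\ge1$) to the right are the permutations $e_t(\sigma_1)\cdots e_t(\sigma_n)\,t$ of $\{1,\ldots,n+1\}$, $1\le t\le n+1$, where $e_t(x)=x$ if $x<t$ and $e_t(x)=x+1$ if $x\ge t$. A permutation is $(k,\ell)$-crucial (the same as $(k,\ell)$-right-crucial) if it avoids $i_k$ and $d_\ell$ but each of its extensions to the right contains $i_k$ or $d_\ell$. A $(k,\ell)$-crucial permutation is minimal if there is no $(k,\ell)$-crucial permutation (same $k,\ell$) of smaller length. *)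

(* Defs.v *)
From mathcomp Require Import all_boot all_fingroup.

Set Implicit Arguments.
Unset Strict Implicit.
Unset Printing Implicit Defensive.

(* One-line notation sigma_1 ... sigma_n with letters 1, ..., n: 'S_n permutes
   {0, ..., n-1}, hence the successor. *)
Definition oneline n (s : 'S_n) : seq nat := [seq (s i).+1 | i <- enum 'I_n].

Definition contains_incr n (s : 'S_n) (m : nat) : Prop :=
  exists u : seq nat, [/\ subseq u (oneline s), size u = m & sorted ltn u].

Definition contains_decr n (s : 'S_n) (m : nat) : Prop :=
  exists u : seq nat, [/\ subseq u (oneline s), size u = m & sorted gtn u].

(* lift_perm ord_max t s sends the last position to t and the position i < n to
   bump t (s i), which is s i if s i < t and s i + 1 otherwise; its one-line
   notation is e_t(sigma_1) ... e_t(sigma_n) t, up to the shift of letters. *)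
Definition right_extension n (s : 'S_n) (t : 'I_n.+1) : 'S_n.+1 :=
  lift_perm ord_max t s.

Definition crucial (k l : nat) n (s : 'S_n) : Prop :=
  [/\ ~ contains_incr s k,
      ~ contains_decr s l
    & forall t : 'I_n.+1, contains_incr (right_extension s t) k
                          \/ contains_decr (right_extension s t) l].

Definition minimal_crucial (k l : nat) n (s : 'S_n) : Prop :=
  crucial k l s /\ (forall m (r : 'S_m), m < n -> ~ crucial k l r).

(* w is a shuffle of u and v: the positions of w selected by the mask b spell u,
   and the remaining positions spell v. *)
Definition interleaving (w u v : seq nat) : Prop :=
  exists b : bitseq,
    [/\ size b = size w, mask b w = u & mask (map negb b) w = v].

(* Main.v *)
Require Import Defs.
From mathcomp Require Import all_boot all_fingroup zify.

(** Since [s] itself avoids both patterns, an occurrence created by appending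
    the letter [t] must use [t].  So [s] is crucial iff it avoids both patterns
    and, for each [t], it has an increasing chain of length [k - 1] with values
    below [t] or a decreasing chain of length [l - 1] with values at least [t]
    ([crucialP]).

    For the largest [t] the first alternative must hold, and for [t = 1] it
    cannot.  Going down from the largest [t] one therefore meets a value [a]
    with an increasing chain [I] inside the letters [<= a] and a decreasing chain
    [D] inside the letters [>= a] ([pivot_exists]).  There are [a] letters
    of the first kind and [n + 1 - a] of the second, whence
    [(k - 1) + (l - 1) <= n + 1].  When [n = k + l - 3] both chains exhaust the
    letters available to them: the letters [<= a] are read in increasing order,
    the letters [>= a] in decreasing order, and [a = k - 1]
    ([crucial_of_minimal_size]).  The letter [a] then comes after all the
    others, and the whole shape of [s] can be read off.

    It remains to see that the length [k + l - 3] is attained.  A word whose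
    letters [<= k - 1] increase and whose letters [>= k - 1] decrease is crucial
    ([two_chains_crucial]), and
    [1 ... (k - 2) (k + l - 3) ... (k - 1)] is such a word. *)

(** * Chains in words and in their right extensions *)

(** Both kinds of pattern at once: [contains_incr] and [contains_decr] unfold to
    the cases [r := ltn] and [r := gtn]. *)
Definition has_chain (r : rel nat) (w : seq nat) (m : nat) : Prop :=
  exists u : seq nat, [/\ subseq u w, size u = m & sorted r u].

(** [bump t] is the relabelling [e_t]. *)
Definition extend_word (t : nat) (w : seq nat) : seq nat :=
  rcons (map (bump t) w) t.

Lemma subseq_rcons_cases {T : eqType} {u w : seq T} {x : T} :
  subseq u (rcons w x) ->
  subseq u w \/ exists2 v, u = rcons v x & subseq v w.
Proof.
case/subseqP=> m; elim/last_ind: m => [|m b _]; first by rewrite size_rcons.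
rewrite !size_rcons => -[szm]; rewrite -!cats1 mask_cat //.
case: b => /= ->; first by right; exists (mask m w); rewrite ?cats1 ?mask_subseq.
by left; rewrite cats0 mask_subseq.
Qed.

Lemma sorted_rcons_all (r : rel nat) (u : seq nat) (x : nat) :
  transitive r -> sorted r (rcons u x) = sorted r u && all (r^~ x) u.
Proof.
move=> r_tr; rewrite !(sorted_pairwise r_tr) -cats1 pairwise_cat /= andbT andbC.
by rewrite allrel1r.
Qed.

(** A chain of the extension that is not inherited from [w] ends with the
    appended letter, and the rest of it comes from a chain of [w]. *)
Lemma extend_word_chain (r : rel nat) (t : nat) (w : seq nat) (m : nat) :
  transitive r -> {mono bump t : x y / r x y} ->
  has_chain r (extend_word t w) m.+1 <->
  has_chain r w m.+1 \/ has_chain r [seq x <- w | r (bump t x) t] m.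
Proof.
move=> r_tr r_mono; split; last first.
  case=> -[u []].
    move=> uw su ru; exists (map (bump t) u); rewrite size_map (mono_sorted r_mono).
    by split=> //; apply: subseq_trans (subseq_rcons _ _); apply: map_subseq.
  rewrite subseq_filter => /andP[au uw] su ru.
  exists (rcons (map (bump t) u) t); split; last 1 first.
  - by rewrite sorted_rcons_all // (mono_sorted r_mono) ru all_map.
  - by rewrite /extend_word -!cats1 cat_subseq // map_subseq.
  - by rewrite size_rcons size_map su.
have preim v : subseq v (map (bump t) w) -> exists2 u, subseq u w & v = map (bump t) u.
  by case/subseqP=> b _ ->; exists (mask b w); rewrite ?mask_subseq ?map_mask.
case=> u [/subseq_rcons_cases[/preim[v vw ->]|[u' -> /preim[v vw ->]]]].
  by rewrite size_map (mono_sorted r_mono) => sv rv; left; exists v.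
rewrite size_rcons size_map sorted_rcons_all // (mono_sorted r_mono) all_map.
by move=> [sv] /andP[rv av]; right; exists v; rewrite subseq_filter vw andbT.
Qed.

Lemma extend_word_incr (t : nat) (w : seq nat) (m : nat) :
  has_chain ltn (extend_word t w) m.+1 <->
  has_chain ltn w m.+1 \/ has_chain ltn [seq x <- w | x < t] m.
Proof.
rewrite extend_word_chain; [|exact: ltn_trans|by move=> x y; rewrite /bump /=; lia].
by rewrite (eq_filter (a2 := fun x => x < t)) // => x; rewrite /bump /=; lia.
Qed.

Lemma extend_word_decr (t : nat) (w : seq nat) (m : nat) :
  has_chain gtn (extend_word t w) m.+1 <->
  has_chain gtn w m.+1 \/ has_chain gtn [seq x <- w | t <= x] m.
Proof.
rewrite extend_word_chain; [|by move=> x y z /=; lia|by move=> x y; rewrite /bump /=; lia].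
by rewrite (eq_filter (a2 := fun x => t <= x)) // => x; rewrite /bump /=; lia.
Qed.

(** * Cruciality in terms of one-line words *)

Lemma oneline_perm {n : nat} (s : 'S_n) : perm_eq (oneline s) (iota 1 n).
Proof.
rewrite [iota 1 n](_ : _ = tval (iota_tuple n 1)) //; apply/tuple_permP; exists s.
rewrite /oneline /=; apply: eq_map => i.
by rewrite (tnth_nth 0) /= nth_iota.
Qed.

Lemma perm_oneline {n : nat} {w : seq nat} :
  perm_eq w (iota 1 n) -> exists s : 'S_n, oneline s = w.
Proof.
rewrite [iota 1 n](_ : _ = tval (iota_tuple n 1)) //.
case/tuple_permP=> s ->; exists s.
rewrite /oneline /=; apply: eq_map => i.
by rewrite (tnth_nth 0) /= nth_iota.
Qed.

Lemma oneline_right_extension (n : nat) (s : 'S_n) (t : 'I_n.+1) :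
  oneline (right_extension s t) = extend_word t.+1 (oneline s).
Proof.
rewrite /oneline /extend_word /right_extension enum_ordSr map_rcons lift_perm_id.
congr rcons; rewrite -!map_comp; apply: eq_map => i /=.
have -> : widen_ord (leqnSn n) i = lift ord_max i.
  by apply: val_inj; rewrite /= /bump leqNgt ltn_ord.
by rewrite lift_perm_lift /= /bump; lia.
Qed.

Definition covers_thresholds (p q n : nat) (w : seq nat) : Prop :=
  forall t, 0 < t <= n.+1 ->
    has_chain ltn [seq x <- w | x < t] p \/ has_chain gtn [seq x <- w | t <= x] q.

(** The appended letter [t] is the last one of any new occurrence of a pattern,
    and the old letters that [e_t] puts below or above it are those [< t] or
    [>= t]. *)
Lemma crucialP {k l n : nat} {s : 'S_n} :
  crucial k.+1 l.+1 s <->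
  [/\ ~ has_chain ltn (oneline s) k.+1, ~ has_chain gtn (oneline s) l.+1
    & covers_thresholds k l n (oneline s)].
Proof.
split=> -[noI noD H]; split=> // t.
  case: t => // t tn; have := H (Ordinal (tn : t < n.+1)).
  rewrite -[contains_incr _ _]/(has_chain ltn _ _) -[contains_decr _ _]/(has_chain gtn _ _).
  by rewrite oneline_right_extension extend_word_incr extend_word_decr /=; tauto.
have := H t.+1 (ltn_ord t).
rewrite -[contains_incr _ _]/(has_chain ltn _ _) -[contains_decr _ _]/(has_chain gtn _ _).
by rewrite oneline_right_extension extend_word_incr extend_word_decr; tauto.
Qed.

(** * The pivot and the lower bound on the length *)

Lemma filter_le_iota {a n : nat} : a <= n -> [seq x <- iota 1 n | x <= a] = iota 1 a.
Proof.
move=> an; rewrite -(subnKC an) iotaD filter_cat.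
have /all_filterP-> : all (fun x => x <= a) (iota 1 a).
  by apply/allP=> x; rewrite mem_iota; lia.
rewrite (eq_in_filter (a2 := pred0)) ?filter_pred0 ?cats0 // => x.
by rewrite mem_iota /=; lia.
Qed.

Lemma filter_ge_iota {a n : nat} :
  0 < a <= n -> [seq x <- iota 1 n | a <= x] = iota a (n.+1 - a).
Proof.
case: a => // a /= an; rewrite -{1}(subnKC (ltnW an)) iotaD filter_cat add1n.
have /all_filterP-> : all (fun x => a < x) (iota a.+1 (n - a)).
  by apply/allP=> x; rewrite mem_iota; lia.
rewrite (eq_in_filter (a2 := pred0)) ?filter_pred0 // => x.
by rewrite mem_iota /=; lia.
Qed.

(** The pivot is where, going down through the thresholds, the increasing
    alternative is first lost. *)
Lemma pivot_exists {p q n : nat} {w : seq nat} :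
  perm_eq w (iota 1 n) -> covers_thresholds p.+1 q.+1 n w ->
  exists a, [/\ 0 < a <= n, has_chain ltn [seq x <- w | x <= a] p.+1
                          & has_chain gtn [seq x <- w | a <= x] q.+1].
Proof.
move=> wn cov.
have empty r P m : [seq x <- w | P x] = [::] -> ~ has_chain r [seq x <- w | P x] m.+1.
  by move=> -> [u []]; rewrite subseq0 => /eqP->.
have no_letter (P : pred nat) : (forall x, 0 < x <= n -> ~~ P x) -> [seq x <- w | P x] = [::].
  move=> nP; rewrite (eq_in_filter (a2 := pred0)) ?filter_pred0 // => x.
  rewrite (perm_mem wn) mem_iota add1n ltnS => /nP.
  exact: negbTE.
have descend t : t <= n -> has_chain ltn [seq x <- w | x < t.+1] p.+1 ->
    exists a, [/\ 0 < a <= n, has_chain ltn [seq x <- w | x <= a] p.+1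
                            & has_chain gtn [seq x <- w | a <= x] q.+1].
  elim: t => [_|t IH tn I].
    by move/empty; case; apply: no_letter => x; lia.
  have [|J|D] := cov t.+1; first by lia.
    by apply: IH => //; apply: ltnW.
  by exists t.+1.
have [|I|/empty[]] := cov n.+1; first by rewrite ltnS leqnn.
  exact: descend I.
by apply: no_letter => x; lia.
Qed.

Lemma subseq_size_eq {T : eqType} {u w : seq T} :
  subseq u w -> size w <= size u -> u = w.
Proof. by move=> uw; rewrite (geq_leqif (size_subseq_leqif uw)) => /eqP. Qed.

Lemma size_le_pivot {a n : nat} {w : seq nat} :
  perm_eq w (iota 1 n) -> a <= n -> size [seq x <- w | x <= a] = a.
Proof.
by move=> /(perm_filter (fun x => x <= a))/perm_size-> an; rewrite filter_le_iota ?size_iota.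
Qed.

Lemma size_ge_pivot {a n : nat} {w : seq nat} :
  perm_eq w (iota 1 n) -> 0 < a <= n -> size [seq x <- w | a <= x] = n.+1 - a.
Proof.
by move=> /(perm_filter (fun x => a <= x))/perm_size-> an; rewrite filter_ge_iota ?size_iota.
Qed.

(** Below the minimal length there is no room for both chains; at that length
    they are forced to use every letter on their side of the pivot.  Here
    [k = p + 2] and [l = q + 2], so the pivot [p + 1] is [k - 1]. *)
Lemma crucial_of_minimal_size {p q n : nat} {w : seq nat} :
  perm_eq w (iota 1 n) -> covers_thresholds p.+1 q.+1 n w -> n <= (p + q).+1 ->
  [/\ n = (p + q).+1,
      [seq x <- w | x <= p.+1] = iota 1 p.+1
    & [seq x <- w | p < x] = rev (iota p.+1 q.+1)].
Proof.
move=> wn cov nle; have [a [an [u [uw su ru]] [v [vw sv rv]]]] := pivot_exists wn cov.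
have sI := size_le_pivot wn (proj2 (andP an)); have sD := size_ge_pivot wn an.
have := size_subseq uw; have := size_subseq vw; rewrite su sv sI sD => qle ple.
have eqa : a = p.+1 by lia.
subst a; have eqn : n = (p + q).+1 by lia.
have equ : u = [seq x <- w | x <= p.+1] by apply: subseq_size_eq; rewrite ?sI ?su.
have eqv : v = [seq x <- w | p < x] by apply: subseq_size_eq => //; rewrite sD sv; lia.
split=> //.
  rewrite -equ; apply: (sorted_eq ltn_trans) (ru) (iota_ltn_sorted _ _) _.
    by move=> x y; lia.
  by rewrite equ -(@filter_le_iota p.+1 n) ?perm_filter //; lia.
rewrite -eqv; apply: (@sorted_eq _ gtn) (rv) _ _; try by move=> x y /=; lia.
  by rewrite rev_sorted iota_ltn_sorted.
rewrite eqv perm_sym perm_rev perm_sym.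
by rewrite (_ : q.+1 = n.+1 - p.+1) -?filter_ge_iota ?perm_filter //; lia.
Qed.

(** * The minimal length is attained *)

(** A chain for [r] shares at most one letter with a chain for the opposite
    order, and the other letters of [u] lie outside [P]. *)
Lemma chain_size_le {r r' : rel nat} {P : pred nat} {u w : seq nat} :
  transitive r -> transitive r' -> (forall x y, r x y -> ~~ r' x y) ->
  subseq u w -> sorted r u -> sorted r' [seq x <- w | P x] ->
  size u + count P w <= (size w).+1.
Proof.
move=> r_tr r'_tr rr' uw ru r'w.
have Pu : count P u <= 1.
  rewrite -size_filter; move: (sorted_filter r_tr P ru).
  have: sorted r' [seq x <- u | P x].
    apply: subseq_sorted r'w => //; rewrite subseq_filter filter_all /=.
    exact: subseq_trans (filter_subseq _ _) uw.
  by case: filter => [|x [|y v]] //= /andP[r'xy _] /andP[/rr']; rewrite r'xy.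
have := leq_count_subseq (predC P) uw.
rewrite -(count_predC P u) -(count_predC P w) => Cu.
by rewrite addnAC -addSn leq_add // -add1n leq_add2r.
Qed.

(** A chain of one kind meets the letters on the other side of [p + 1], which
    form a chain of the opposite kind, at most once; so it is too short to be a
    forbidden pattern.  The two given chains deal with every threshold: the
    decreasing one up to [p + 1], the increasing one above. *)
Lemma two_chains_crucial {p q : nat} {s : 'S_(p + q).+1} :
  sorted ltn [seq x <- oneline s | x <= p.+1] ->
  sorted gtn [seq x <- oneline s | p < x] ->
  crucial p.+2 q.+2 s.
Proof.
have ws := oneline_perm s; set w := oneline s in ws *.
have pn : 0 < p.+1 <= (p + q).+1 by lia.
have sI := size_le_pivot ws (proj2 (andP pn)); have sD := size_ge_pivot ws pn.
have sw : size w = (p + q).+1 by rewrite (perm_size ws) size_iota.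
have gtn_trans : transitive gtn by move=> x y z /=; lia.
have ltnNgtn x y : ltn x y -> ~~ gtn x y by move=> /=; lia.
have gtnNltn x y : gtn x y -> ~~ ltn x y by move=> /=; lia.
move=> incI decD; apply/crucialP; rewrite -/w; split.
- case=> u [uw su ru].
  have := chain_size_le ltn_trans gtn_trans ltnNgtn uw ru decD.
  by rewrite -size_filter sD su sw; lia.
- case=> u [uw su ru].
  have := chain_size_le gtn_trans ltn_trans gtnNltn uw ru incI.
  by rewrite -size_filter sI su sw; lia.
move=> t tn; case: (leqP t p.+1) => tp; [right|left].
- exists [seq x <- w | p < x]; split=> //; last by rewrite sD; lia.
  rewrite subseq_filter filter_subseq andbT; apply/allP=> x; rewrite mem_filter; lia.
- exists [seq x <- w | x <= p.+1]; split=> //.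
  rewrite subseq_filter filter_subseq andbT; apply/allP=> x; rewrite mem_filter; lia.
Qed.

Lemma exists_crucial (p q : nat) : exists s : 'S_(p + q).+1, crucial p.+2 q.+2 s.
Proof.
pose w := iota 1 p ++ rev (iota p.+1 q.+1).
have [s ws] : exists s : 'S_(p + q).+1, oneline s = w.
  apply: perm_oneline; rewrite -addnS iotaD add1n.
  by rewrite perm_cat2l perm_rev.
exists s; apply: two_chains_crucial; rewrite ws filter_cat filter_rev.
  rewrite (_ : [seq x <- iota p.+1 q.+1 | x <= p.+1] = [:: p.+1]).
    have /all_filterP-> : all (fun x => x <= p.+1) (iota 1 p).
      by apply/allP=> x; rewrite mem_iota; lia.
    by rewrite -[p.+1]add1n -(iotaD 1 p 1) iota_ltn_sorted.
  rewrite /= leqnn (eq_in_filter (a2 := pred0)) ?filter_pred0 // => x.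
  by rewrite mem_iota /=; lia.
rewrite (eq_in_filter (a2 := pred0)) ?filter_pred0 ?cat0s; last first.
  by move=> x; rewrite mem_iota /=; lia.
rewrite rev_sorted; apply: (sorted_filter ltn_trans).
exact: iota_ltn_sorted.
Qed.

(** * Reading off the shape *)

(** If the last letter lies on one side of the pivot, it is the last letter of
    the chain on that side, which is the pivot in either case. *)
Lemma last_two_chains {a q : nat} {w : seq nat} :
  [seq x <- w | x <= a.+1] = iota 1 a.+1 ->
  [seq x <- w | a < x] = rev (iota a.+1 q.+1) ->
  exists w', [/\ w = rcons w' a.+1,
    [seq x <- w' | x <= a.+1] = iota 1 a
  & [seq x <- w' | a < x] = rev (iota a.+2 q)].
Proof.
case/lastP: w => [|w z] //=; rewrite !filter_rcons.
have -> : 1 :: iota 2 a = rcons (iota 1 a) a.+1.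
  by rewrite -[1 :: _]/(iota 1 a.+1) -{1}[a.+1]addn1 iotaD cats1.
rewrite rev_cons => eI eD; exists w.
have za : z = a.+1.
  case: (leqP z a) eI eD => za.
    by rewrite leqW // => /rcons_inj[].
  by move=> _ /rcons_inj[].
by subst z; move: eI eD; rewrite !leqnn => /rcons_inj[->] /rcons_inj[->].
Qed.

Lemma interleaving_filter (P : pred nat) (w : seq nat) :
  interleaving w [seq x <- w | P x] [seq x <- w | ~~ P x].
Proof. by exists (map P w); rewrite size_map -map_comp -!filter_mask. Qed.

Lemma head_filter {P : pred nat} {w : seq nat} :
  P (head 0 w) -> head 0 w = head 0 [seq x <- w | P x].
Proof. by case: w => //= x w ->. Qed.

Theorem theorem4 (k l n : nat) (s : 'S_n) :
  2 <= k -> 2 <= l -> 0 < n -> minimal_crucial k l s ->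
  [/\ n = k + l - 3,
      last 0 (oneline s) = k - 1,
      interleaving (take (k + l - 4) (oneline s))
                   (iota 1 (k - 2)) (rev (iota k (l - 2)))
    & head 0 (oneline s) = 1 \/ head 0 (oneline s) = n].
Proof.
case: k => [|[|p]] //; case: l => [|[|q]] // _ _ _ [/crucialP[_ _ cov] min_s].
have nle : n <= (p + q).+1.
  rewrite leqNgt; apply/negP => /min_s lt_n.
  by have [r /lt_n] := exists_crucial p q.
have wn := oneline_perm s.
have [eqn eI eD] := crucial_of_minimal_size wn cov nle.
have [w' [ew eI' eD']] := last_two_chains eI eD.
have sw' : size w' = p + q.
  by have := perm_size wn; rewrite ew size_rcons size_iota eqn => -[].
split.
- by rewrite eqn; lia.
- by rewrite ew last_rcons; lia.
- rewrite (_ : p.+2 + q.+2 - 4 = size w'); last by rewrite sw'; lia.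
  rewrite ew -cats1 take_size_cat // !subSS !subn0 -eI' -eD'.
  (* The pivot is the only letter on both sides, and it does not occur in [w']. *)
  rewrite (eq_in_filter (a1 := fun x => p < x) (a2 := fun x => ~~ (x <= p.+1))).
    exact: interleaving_filter.
  move=> x xw'; suff: x != p.+1 by lia.
  apply: contraTneq xw' => ->; have := iota_uniq 1 n.
  by rewrite -(perm_uniq wn) ew rcons_uniq => /andP[].
case: (leqP (head 0 (oneline s)) p.+1) => hp; [left|right].
  by rewrite (head_filter (P := fun x => x <= p.+1)) // eI.
rewrite (head_filter (P := fun x => p < x)) ?eD; last exact: ltnW.
by rewrite eqn -[q.+1]addn1 iotaD rev_cat /= addSn.
Qed.
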